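(* Let $\overline{B}$ be an edge subdiagram of a Bratteli diagram $B$, and let $\overline{\mu}$ be a probability $\overline{\mathcal E}$-invariant measure on $X_{\overline{B}}$. Then the extension $\widehat{\overline{\mu}}(\widehat{X}_{\overline{B}})$ is finite if and only if $$\sum_{n=1}^{\infty} \sum_{v \in V_{n+1}} \sum_{w \in V_{n}} \widetilde{f}_{v,w}^{(n)} h_w^{(n)}\overline{p}_v^{(n+1)} < \infty ,$$ where $\widetilde{f}^{(n)}_{v,w} = f^{(n)}_{v,w} - \overline{f}^{(n)}_{v,w}$. Moreover, the following equality holds: $$\widehat{\overline{\mu}}(\widehat{X}_{\overline{B}}) = \widehat{\overline{\mu}}(\widehat{X}_{\overline B}^{(1)}) + \sum_{n=1}^\infty \sum_{v\in V_{n+1}} \sum_{w\in V_{n}} \widetilde{f}_{v,w}^{(n)} h_w^{(n)} \overline{p}_v^{(n+1)}.$$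
   Context: A Bratteli diagram $B=(V,E)$ is an infinite graph with $V=\bigcup_{i\ge 0}V_i$, $E=\bigcup_{i\ge1}E_i$ (disjoint finite levels, $V_0=\{v_0\}$), with range and source maps $r,s$ on edges such that $r(E_i)=V_i$, $s(E_i)=V_{i-1}$, $s^{-1}(v)\ne\emptyset$ for all $v$, and $r^{-1}(v)\neq\emptyset$ for all $v\ne v_0$. The $n$-th incidence matrix ($n\ge 0$) is $F_n=(f^{(n)}_{v,w})_{v\in V_{n+1},w\in V_n}$, where $f^{(n)}_{v,w}$ is the number of edges from $w$ to $v$. $X_B$ is the space of infinite paths starting at $v_0$, with the topology generated by cylinder sets of finite paths; it is assumed to be a Cantor set. Two paths are tail equivalent, $(x,y)\in\mathcal E$, if $x_i=y_i$ for all sufficiently large $i$. $h^{(n)}_w$ is the number of finite paths in $B$ from $v_0$ to $w\in V_n$. An edge subdiagram $\overline B$ of $B$ has the same vertices $V_n$ and incidence matrices $\overline F_n=(\overline f^{(n)}_{v,w})$ obtained by removing edges, so $\overline F_n\le F_n$ entrywise, with the requirement that $f^{(n)}_{v,w}>0$ implies $\overline f^{(n)}_{v,w}>0$. $\overline{\mathcal E}$ is the tail equivalence relation on $X_{\overline B}\subset X_B$. A measure is invariant with respect to the tail equivalence relation if any two cylinder sets given by finite paths from $v_0$ to the same vertex have the same measure. For $v\in V_n$, $\overline p^{(n)}_v$ is the $\overline\mu$-measure of the cylinder set in $X_{\overline B}$ given by any finite path of $\overline B$ from $v_0$ to $v$. $\widehat X_{\overline B}=\mathcal E(X_{\overline B})$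 is the set of all paths in $X_B$ tail equivalent to some path of $X_{\overline B}$. $\widehat{\overline\mu}$ is the unique extension of $\overline\mu$ to an $\mathcal E$-invariant Borel measure (finite or infinite) on $\widehat X_{\overline B}$: if $\overline f$ is a finite path in $B$ from $v_0$ to a vertex $v$ of $\overline B$ at level $n$, then the set of paths with initial segment $\overline f$ and tail (all edges after level $n$) in $\overline B$ has the same measure as the cylinder in $X_{\overline B}$ of any finite path of $\overline B$ from $v_0$ to $v$. $\widehat X^{(n)}_{\overline B}$ is the set of paths $x=(x_i)\in X_B$ such that $(x_1,\dots,x_n)$ is a finite path in $B$ from $v_0$ to a vertex of $\overline B$ and the tail $(x_{n+1},x_{n+2},\dots)$ lies in $\overline B$. *)

(* Defs.v *)
From HB Require Import structures.
From mathcomp Require Export all_boot all_order all_algebra.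
From mathcomp Require Export all_classical all_reals all_analysis.
Export Order.TTheory GRing.Theory Num.Theory.

Set Implicit Arguments.
Unset Strict Implicit.
Unset Printing Implicit Defensive.

Local Open Scope classical_set_scope.
Local Open Scope ring_scope.
Local Open Scope ereal_scope.

(* [edge n] is the set E_(n+1) of edges from level n to level n+1: edges are
   numbered by the level of their source, as the incidence matrices are. *)
Record bratteli := Bratteli {
  vertex : nat -> finType;
  edge : nat -> finType;
  src : forall n, edge n -> vertex n;
  rng : forall n, edge n -> vertex n.+1;
  card_root : #|vertex 0| = 1%N;
  src_surj : forall n (v : vertex n), exists e : edge n, src e = v;
  rng_surj : forall n (v : vertex n.+1), exists e : edge n, rng e = v }.

Definition incidence (B : bratteli) (n : nat)
    (v : vertex B n.+1) (w : vertex B n) : nat :=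
  #|[set e : edge B n | (src e == w) && (rng e == v)]%SET|.

(* A path from the root to [v] at level n+1 is a last edge into [v] together
   with a path from the root to the source of that edge. *)
Fixpoint finpath (B : bratteli) (n : nat) : vertex B n -> finType :=
  match n with
  | 0 => fun _ => unit
  | m.+1 => fun v =>
      {e : {e : edge B m | rng e == v} & finpath (src (val e))}
  end.

Definition height (B : bratteli) (n : nat) (w : vertex B n) : nat :=
  #|finpath w|.

Lemma finpath_exists (B : bratteli) (n : nat) (v : vertex B n) :
  exists _ : finpath v, True.
Proof.
elim: n v => [|n IHn] v; first by exists tt.
have [e /eqP ev] := rng_surj v.
have [p _] := IHn (src e).
by exists (existT _ (exist _ e ev) p).
Qed.

Definition some_finpath (B : bratteli) (n : nat) (v : vertex B n) : finpath v :=
  projT1 (cid (finpath_exists v)).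

Record path_space (B : bratteli) := PathSpace {
  path_edge :> forall n, edge B n;
  path_compat : forall n, rng (path_edge n) = src (path_edge n.+1) }.

Fixpoint is_prefix (B : bratteli) (n : nat) :
    forall v : vertex B n, finpath v -> path_space B -> Prop :=
  match n with
  | 0 => fun _ _ _ => True
  | m.+1 => fun v f x =>
      x m = val (projT1 f) /\ is_prefix (projT2 f) x
  end.

Definition cylinder (B : bratteli) (n : nat) (v : vertex B n) (f : finpath v) :
  set (path_space B) := [set x | is_prefix f x].

Section path_space_instances.
Variable B : bratteli.

Let root : vertex B 0.
Proof. by apply: (@enum_val _ predT); rewrite card_root; exact: ord0. Defined.

Let out_edge n (v : vertex B n) : edge B n := projT1 (cid (src_surj v)).

Let out_edgeE n (v : vertex B n) : src (out_edge v) = v.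
Proof. by rewrite /out_edge; case: cid. Qed.

Let visit := fix visit n : vertex B n :=
  match n with 0 => root | m.+1 => rng (out_edge (visit m)) end.

Let point_path : path_space B.
Proof.
by exists (fun n => out_edge (visit n)) => n; rewrite out_edgeE.
Defined.

HB.instance Definition _ := gen_eqMixin (path_space B).
HB.instance Definition _ := gen_choiceMixin (path_space B).
HB.instance Definition _ := isPointed.Build (path_space B) point_path.

Definition is_cylinder : set (set (path_space B)) :=
  [set A | exists n (v : vertex B n) (f : finpath v), A = cylinder f].

HB.instance Definition _ :=
  @isSubBaseTopological.Build (path_space B) (set (path_space B))
    is_cylinder id.

End path_space_instances.

Notation borel_path_space B := (g_sigma_algebraType (@open (path_space B))).

Definition cantor_set (T : topologicalType) : Prop :=
  exists f : cantor_space -> T,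
    [/\ bijective f, continuous f & forall A, open A -> open (f @` A)].

Definition tail_equiv (B : bratteli) (x y : path_space B) : Prop :=
  \forall n \near \oo, x n = y n.

Definition tail_invariant (R : realType) (B : bratteli)
    (mu : set (path_space B) -> \bar R) : Prop :=
  forall n (v : vertex B n) (e f : finpath v), mu (cylinder e) = mu (cylinder f).

Record edge_subdiagram (B : bratteli) := EdgeSubdiagram {
  kept : forall n, {set edge B n};
  kept_pos : forall n (v : vertex B n.+1) (w : vertex B n),
    (0 < incidence v w)%N ->
    (0 < #|[set e in kept n | (src e == w) && (rng e == v)]%SET|)%N }.

Section subdiagram.
Variables (B : bratteli) (S : edge_subdiagram B).

Let sub_edge n : finType := {e : edge B n | e \in kept S n}.

Let kept_parallel n (e : edge B n) :
  exists e' : sub_edge n, src (val e') = src e /\ rng (val e') = rng e.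
Proof.
have : (0 < incidence (rng e) (src e))%N.
  by apply/card_gt0P; exists e; rewrite inE !eqxx.
move=> /(kept_pos S) /card_gt0P[e']; rewrite !inE.
by move=> /andP[ke' /andP[/eqP se' /eqP re']]; exists (exist _ e' ke').
Qed.

Let sub_src_surj n (v : vertex B n) : exists e : sub_edge n, src (val e) = v.
Proof.
have [e <-] := src_surj v.
by have [e' [? _]] := kept_parallel e; exists e'.
Qed.

Let sub_rng_surj n (v : vertex B n.+1) :
  exists e : sub_edge n, rng (val e) = v.
Proof.
have [e <-] := rng_surj v.
by have [e' [_ ?]] := kept_parallel e; exists e'.
Qed.

Definition sub_bratteli : bratteli :=
  @Bratteli (vertex B) sub_edge (fun n e => src (val e))
    (fun n e => rng (val e)) (card_root B) sub_src_surj sub_rng_surj.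

Definition sub_incl (x : path_space sub_bratteli) : path_space B :=
  @PathSpace B (fun n => val (x n)) (path_compat x).

(* The entry f - \bar f; the truncated subtraction is exact, because the
   edges of the subdiagram are among those of [B]. *)
Definition removed_incidence n (v : vertex B n.+1) (w : vertex B n) : nat :=
  (incidence v w - @incidence sub_bratteli n v w)%N.

Definition saturation : set (path_space B) :=
  [set x | exists y : path_space sub_bratteli, tail_equiv x (sub_incl y)].

(* \widehat X^(n): the edges after level n, that is those of index at least n
   here, are in the subdiagram. The vertex reached at level n is in the
   subdiagram automatically, since the vertices are the same. *)
Definition level_saturation (n : nat) : set (path_space B) :=
  [set x : path_space B | forall i, (n <= i)%N -> x i \in kept S i].

Variable R : realType.

Definition vertex_measure (mu : set (path_space sub_bratteli) -> \bar R)
    (n : nat) (v : vertex B n) : \bar R :=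
  mu (cylinder (@some_finpath sub_bratteli n v)).

(* The extension lives on [saturation]; it is represented by the measure on
   the whole path space that vanishes off it. Tail invariance compares only
   cylinders, whose measures may be infinite, so the last clause is what
   determines the extension. *)
Definition is_tail_extension (mu : set (path_space sub_bratteli) -> \bar R)
    (nu : set (path_space B) -> \bar R) : Prop :=
  [/\ tail_invariant nu,
      nu (~` saturation) = 0,
      forall A : set (borel_path_space sub_bratteli),
        measurable A -> nu (sub_incl @` A) = mu A
    & forall n (v : vertex B n) (f : finpath v)
        (e : @finpath sub_bratteli n v),
        nu (cylinder f `&` level_saturation n) = mu (cylinder e)].

End subdiagram.

(* Main.v *)
Require Import Defs.
From mathcomp Require Import finmap.

Local Open Scope classical_set_scope.
Local Open Scope ring_scope.
Local Open Scope ereal_scope.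

(** Write L n for the set of paths all of whose edges of index at least n are
    kept. These sets increase, and their union is the saturation: a path of
    the saturation is eventually kept, and conversely a path that is
    eventually kept becomes a path of the subdiagram once each removed edge is
    replaced by a kept edge with the same endpoints, of which there is one by
    definition of an edge subdiagram ([saturationE]). So the measure of the
    saturation is the limit of the measures of the L n.

    A path of L n.+1 fails to be in L n exactly when its edge of index n is
    removed. Sort such paths by their initial segment, which ends at some
    vertex v of level n.+1: there are as many possible segments as pairs of a
    removed edge from some w to v and a path from the root to w, that is the
    sum over w of the removed incidence times the height of w
    ([card_removed_paths]). Each segment contributes the measure attached to v,
    by the property that characterizes the extension
    ([measure_path_upto_level]). Hence going from L n to L n.+1 adds the n-th
    term of the series ([level_saturationS]), and the equality follows by
    summing. The finiteness criterion comes from the equality because L 1 has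
    finite measure, being covered by finitely many pieces of finite measure
    ([level_saturation_lty]). *)

Lemma measurable_cylinder {B : bratteli} {n : nat} {v : vertex B n}
    (f : finpath v) :
  measurable (cylinder f : set (borel_path_space B)).
Proof.
apply: sub_sigma_algebra.
exists [set cylinder f]; last by rewrite bigcup_set1.
move=> _ ->; exists [fset cylinder f]%fset.
  by move=> A; rewrite inE => /eqP ->; apply/mem_set; exists n, v, f.
apply/seteqP; split=> x => [h|h A].
  by apply: (h (cylinder f)); rewrite /= inE.
by rewrite /= inE => /eqP ->.
Qed.

Fixpoint prefix {B : bratteli} (x : path_space B) (n : nat) :
    finpath (src (x n)) :=
  match n return finpath (src (x n)) with
  | 0 => tt
  | m.+1 => existT _ (exist _ (x m) (introT eqP (path_compat x m))) (prefix x m)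
  end.

(** Bundling a finite path with its end vertex lets initial segments with
    different ends be compared by plain equality. *)
Definition rooted_path (B : bratteli) (n : nat) : finType :=
  {v : vertex B n & finpath v}.

Definition path_upto {B : bratteli} (n : nat) (x : path_space B) :
    rooted_path B n :=
  Tagged (@finpath B n) (prefix x n).

(** Cylinders of level n are the fibres of [path_upto n]. They are therefore
    disjoint and cover the path space, which is how the partition into
    cylinders is used below. *)
Lemma cylinderE {B : bratteli} {n : nat} {v : vertex B n} (f : finpath v) :
  cylinder f = [set x | path_upto n x = Tagged (@finpath B n) f].
Proof.
apply/seteqP; split=> x; rewrite /cylinder /path_upto /=; last first.
  have prefixP m : is_prefix (prefix x m) x by elim: m => //= m IHm.
  move=> /(congr1 (fun t : rooted_path B n => is_prefix (tagged t) x)) /= <-.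
  exact: prefixP.
elim: n v f => [|n IHn] v f.
  (* There is only one root, so the end vertices agree. *)
  move=> _; have: v = src (x 0%N).
    by apply: (fintype_le1P _); rewrite card_root.
  by move=> E; case: _ / E f => -[].
case: f => -[e re] f /= [xe]; move: re f; rewrite -{}xe => re f /IHn /eqP.
rewrite eq_Tagged => /eqP <- {f}.
(* Both end vertices are the range of [x n]; once they are identified, the two
   paths differ only in the proof that this edge ends there. *)
move: (introT _ _) => h; move: (src (x n.+1)) h => u h.
move: h re => /[dup] /eqP <- h /[dup] /eqP <- re.
by rewrite (bool_irrelevance h re).
Qed.

Definition last_edge {B : bratteli} {n : nat} (t : rooted_path B n.+1) :
    edge B n :=
  val (projT1 (tagged t)).

Lemma path_upto_preimage {B : bratteli} {n : nat}
    (P : pred (rooted_path B n)) :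
  [set x | P (path_upto n x)] = \bigcup_(t in [set` P]) cylinder (tagged t).
Proof.
apply/seteqP; split=> [x Px|x [t Pt]].
  by exists (path_upto n x) => //; rewrite cylinderE.
by rewrite cylinderE /= => ->; case: t Pt.
Qed.

Lemma measurable_path_upto {B : bratteli} {n : nat}
    (P : pred (rooted_path B n)) :
  measurable ([set x | P (path_upto n x)] : set (borel_path_space B)).
Proof.
rewrite path_upto_preimage; apply: fin_bigcup_measurable => // t _.
exact: measurable_cylinder.
Qed.

Lemma measure_path_upto {R : realType} {B : bratteli}
    (nu : {measure set (borel_path_space B) -> \bar R})
    {n : nat} (P : pred (rooted_path B n)) (A : set (borel_path_space B)) :
  measurable A ->
  nu ([set x | P (path_upto n x)] `&` A) =
  \sum_(t | P t) nu (cylinder (tagged t) `&` A).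
Proof.
move=> mA; rewrite path_upto_preimage setI_bigcupl measure_fin_bigcup//.
- rewrite -[RHS]big_filter [RHS]fsbig_seq ?filter_uniq ?index_enum_uniq//.
  suff -> : [set` P] = [set` [seq t <- index_enum _ | P t]] by [].
  by apply/seteqP; split=> t /=; rewrite mem_filter mem_index_enum andbT.
- move=> s t _ _ [x [[]]]; rewrite !cylinderE /= => -> _ [].
  by case: s t => ? ? [? ?].
- by move=> t _; apply: measurableI => //; exact: measurable_cylinder.
Qed.

(** Membership of the edge of index i in a fixed set depends only on the
    initial segment of length i.+1, so this is a countable intersection of
    finite unions of cylinders. *)
Lemma measurable_level_saturation {B : bratteli} (S : edge_subdiagram B)
    (n : nat) :
  measurable (level_saturation S n : set (borel_path_space B)).
Proof.
have -> : level_saturation S n = \bigcap_(i in [set i | (n <= i)%N])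
    [set x : path_space B | last_edge (path_upto i.+1 x) \in kept S i].
  by apply/seteqP; split.
apply: bigcap_measurableType => i _.
exact: (measurable_path_upto (fun t => last_edge t \in kept S i)).
Qed.

Lemma exists_kept_parallel {B : bratteli} (S : edge_subdiagram B) {n : nat}
    (e : edge B n) :
  exists e' : edge (sub_bratteli S) n,
    [/\ src (val e') = src e, rng (val e') = rng e
      & e \in kept S n -> val e' = e].
Proof.
have [ke|nke] := boolP (e \in kept S n); first by exists (exist _ e ke).
have : (0 < incidence (rng e) (src e))%N.
  by apply/card_gt0P; exists e; rewrite inE !eqxx.
move=> /(kept_pos S)/card_gt0P[e'].
rewrite !inE => /and3P[ke' /eqP se' /eqP re'].
by exists (exist _ e' ke').
Qed.

(** The union may start at level 1 because the sets increase; this is the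
    level from which the series is summed. *)
Lemma saturationE {B : bratteli} (S : edge_subdiagram B) :
  saturation S = \bigcup_n level_saturation S n.+1.
Proof.
apply/seteqP; split=> [x [y [N _ xy]]|x [N _ xN]].
  by exists N => // i /ltnW Ni; rewrite (xy i Ni) /=; exact: valP.
(* Substituting kept edges with the same endpoints keeps the edges
   composable, and leaves the tail of [x] unchanged. *)
pose y n := projT1 (cid (exists_kept_parallel S (x n))).
have yP n : [/\ src (val (y n)) = src (x n), rng (val (y n)) = rng (x n)
    & x n \in kept S n -> val (y n) = x n] by rewrite /y; case: cid.
have y_compat n : rng (y n) = src (y n.+1).
  rewrite /=; have [_ -> _] := yP n; have [-> _ _] := yP n.+1.
  exact: path_compat.
exists (@PathSpace (sub_bratteli S) y y_compat).
exists N.+1 => // i /xN xi /=.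
by have [_ _ ->] := yP i.
Qed.

Lemma card_sub_incidence {B : bratteli} (S : edge_subdiagram B) (n : nat)
    (v : vertex B n.+1) (w : vertex B n) :
  @incidence (sub_bratteli S) n v w =
  #|[set e in kept S n | (src e == w) && (rng e == v)]|.
Proof.
rewrite /incidence /= -!sum1_card.
transitivity (\sum_(e in kept S n | (src e == w) && (rng e == v)) 1)%N.
  by rewrite big_sub_cond; apply: eq_bigl => e; rewrite inE.
by apply: eq_bigl => e; rewrite !inE.
Qed.

Lemma removed_incidenceE {B : bratteli} (S : edge_subdiagram B) (n : nat)
    (v : vertex B n.+1) (w : vertex B n) :
  removed_incidence S v w =
  #|[pred e | (rng e == v) && (e \notin kept S n) && (src e == w)]|.
Proof.
rewrite /removed_incidence card_sub_incidence /incidence.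
rewrite -(cardsID (kept S n) [set e | _]).
rewrite (_ : _ :&: _ = [set e in kept S n | (src e == w) && (rng e == v)])%SET.
  rewrite addKn; apply: eq_card => e; rewrite !inE andbC [RHS]andbAC.
  by congr (_ && _); exact: andbC.
by apply/setP=> e; rewrite !inE andbC.
Qed.

(** A path to v is a last edge into v followed backwards by a path to the
    source of that edge: sort the paths by the source w of their last edge. *)
Lemma card_removed_paths {B : bratteli} (S : edge_subdiagram B) (n : nat)
    (v : vertex B n.+1) :
  #|[pred f : finpath v | val (projT1 f) \notin kept S n]| =
  (\sum_(w : vertex B n) removed_incidence S v w * height w)%N.
Proof.
rewrite -sum1_card.
transitivity (\sum_(e : {e : edge B n | rng e == v} | val e \notin kept S n)
    \sum_(f : finpath (src (val e))) 1)%N.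
  by rewrite sig_big_dep; apply: eq_bigl => f; rewrite inE andbT.
transitivity (\sum_(e in [pred e : edge B n | rng e == v]
    | e \notin kept S n) height (src e))%N.
  by rewrite big_sub_cond; apply: eq_bigr => e _; rewrite sum1_card.
rewrite (partition_big (@src B n) predT) //=; apply: eq_bigr => w _.
rewrite removed_incidenceE -sum_nat_const.
by apply: eq_bigr => e /andP[_ /eqP ->].
Qed.

Definition level_gain {R : realType} {B : bratteli} {S : edge_subdiagram B}
    (mu : set (path_space (sub_bratteli S)) -> \bar R) (n : nat) : \bar R :=
  \sum_(v : vertex B n.+1) \sum_(w : vertex B n)
    (removed_incidence S v w * height w)%:R%:E * vertex_measure mu v.

(** Inside L n a cylinder of level n has the measure attached to its end
    vertex, so only end vertices matter once a set is sorted by initial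
    segments. *)
Lemma measure_path_upto_level {R : realType} {B : bratteli}
    {S : edge_subdiagram B} {mu : set (path_space (sub_bratteli S)) -> \bar R}
    {nu : {measure set (borel_path_space B) -> \bar R}}
    (nu_ext : is_tail_extension mu nu) {n : nat} (P : pred (rooted_path B n)) :
  nu ([set x | P (path_upto n x)] `&` level_saturation S n) =
  \sum_(t | P t) vertex_measure mu (tag t).
Proof.
have [_ _ _ nuL] := nu_ext.
rewrite measure_path_upto; last exact: measurable_level_saturation.
by apply: eq_bigr => t _; apply: nuL.
Qed.

Lemma level_saturation_lty {R : realType} {B : bratteli}
    {S : edge_subdiagram B}
    {mu : probability (borel_path_space (sub_bratteli S)) R}
    {nu : {measure set (borel_path_space B) -> \bar R}}
    (nu_ext : is_tail_extension mu nu) (n : nat) :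
  nu (level_saturation S n) < +oo.
Proof.
have /= := measure_path_upto_level nu_ext (n:=n) predT.
rewrite (_ : [set _ | _] = setT) ?setTI; last by apply/seteqP; split.
move=> ->; apply/lte_sum_pinfty => t _.
rewrite -ge0_fin_numE; last exact: measure_ge0.
by apply: fin_num_measure; exact: measurable_cylinder.
Qed.

Lemma measure_removed_edge {R : realType} {B : bratteli}
    {S : edge_subdiagram B} {mu : set (path_space (sub_bratteli S)) -> \bar R}
    {nu : {measure set (borel_path_space B) -> \bar R}}
    (nu_ext : is_tail_extension mu nu) (n : nat) :
  nu ([set x : path_space B | x n \notin kept S n] `&`
      level_saturation S n.+1) = level_gain mu n.
Proof.
have /= -> := measure_path_upto_level nu_ext
  (fun t : rooted_path B n.+1 => last_edge t \notin kept S n).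
have /= <- := sig_big_dep predT
  (fun (v : vertex B n.+1) (f : finpath v) => val (projT1 f) \notin kept S n)
  (fun v _ => vertex_measure mu v).
apply: eq_bigr => v _.
rewrite -ge0_sume_distrl; last by move=> w _; rewrite lee_fin ler0n.
by rewrite sumEFin -natr_sum -card_removed_paths mule_natl sumr_const.
Qed.

(** L n.+1 is the disjoint union of L n and of the set measured in
    [measure_removed_edge], according to whether the edge of index n is kept. *)
Lemma level_saturationS {R : realType} {B : bratteli}
    {S : edge_subdiagram B} {mu : set (path_space (sub_bratteli S)) -> \bar R}
    {nu : {measure set (borel_path_space B) -> \bar R}}
    (nu_ext : is_tail_extension mu nu) (n : nat) :
  nu (level_saturation S n.+1) = nu (level_saturation S n) + level_gain mu n.
Proof.
have mR : measurable ([set x | x n \notin kept S n] : set (borel_path_space B)).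
  exact: (measurable_path_upto
    (fun t : rooted_path B n.+1 => last_edge t \notin kept S n)).
rewrite -(measure_removed_edge nu_ext) -measureU.
- congr (nu _); apply/seteqP; split=> [x xL|x [xL i /ltnW|[]//]];
    last exact: xL.
  have [xk|] := boolP (x n \in kept S n); last by right.
  by left=> i; rewrite leq_eqVlt => /predU1P[<-//|]; exact: xL.
- exact: measurable_level_saturation.
- by apply: measurableI => //; exact: measurable_level_saturation.
- by apply/seteqP; split=> // x [xL [/= /negP + _]]; apply; exact: xL.
Qed.

Theorem theorem2p4 (R : realType) (B : bratteli) (S : edge_subdiagram B)
    (mu : probability (borel_path_space (sub_bratteli S)) R)
    (nu : {measure set (borel_path_space B) -> \bar R})
    (cantorB : cantor_set (path_space B))
    (mu_inv : tail_invariant mu)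
    (nu_ext : is_tail_extension mu nu) :
  (nu (saturation S) < +oo <->
   \sum_(1 <= n <oo) \sum_(v : vertex B n.+1) \sum_(w : vertex B n)
     (removed_incidence S v w * height w)%:R%:E * vertex_measure mu v < +oo) /\
  nu (saturation S) =
    nu (level_saturation S 1) +
    \sum_(1 <= n <oo) \sum_(v : vertex B n.+1) \sum_(w : vertex B n)
      (removed_incidence S v w * height w)%:R%:E * vertex_measure mu v.
Proof.
have gain_ge0 n : 0 <= level_gain mu n.
  apply: sume_ge0 => v _; apply: sume_ge0 => w _.
  by apply: mule_ge0; [rewrite lee_fin ler0n|exact: measure_ge0].
pose s := \sum_(1 <= n <oo) level_gain mu n.
have s_ge0 : 0 <= s by apply: nneseries_ge0.
suff E : nu (saturation S) = nu (level_saturation S 1) + s.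
  split; last exact: E.
  rewrite E -/(s < +oo); split; last first.
    by apply: lte_add_pinfty; exact: level_saturation_lty nu_ext 1%N.
  by apply: le_lt_trans; rewrite leeDr// measure_ge0.
have partialE n : nu (level_saturation S n.+1) =
    nu (level_saturation S 1) + \sum_(1 <= k < n.+1) level_gain mu k.
  elim: n => [|n IHn]; first by rewrite big_geq// adde0.
  by rewrite (level_saturationS nu_ext) IHn [in RHS]big_nat_recr//= addrA.
rewrite saturationE.
have to_saturation : nu (level_saturation S n.+1) @[n --> \oo] -->
    nu (\bigcup_n level_saturation S n.+1).
  apply: nondecreasing_cvg_mu => [n||m n mn].
  - exact: measurable_level_saturation.
  - by apply: bigcupT_measurable => n; exact: measurable_level_saturation.
  - by apply/subsetPset => x xL i ni; apply: xL; exact: leq_trans ni.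
have to_series : nu (level_saturation S n.+1) @[n --> \oo] -->
    nu (level_saturation S 1) + s.
  under eq_fun do rewrite partialE.
  apply: cvgeD; first by apply: ge0_adde_def; rewrite inE.
    exact: cvg_cst.
  rewrite (cvg_shiftS (fun n => \sum_(1 <= k < n) level_gain mu k)).
  by apply: is_cvg_nneseries.
exact: cvg_unique to_saturation to_series.
Qed.
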